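(* $\rho\tau(K_{12}, o(\mathbf{Q}(4,n))) \le 4/13$. That is, for every $\gamma>0$ there is $\delta>0$ such that every $n$-vertex $K_{12}$-free graph $G$ with $\alpha(G)\le \delta\,\mathbf{Q}(4,n)$ satisfies $e(G)\le (4/13+\gamma)n^2$ for all sufficiently large $n$.
   Context: For a graph $H$ and a function $f(n)$, the Ramsey–Turán number $\mathbf{RT}(n,H,f(n))$ is the maximum number of edges in an $n$-vertex $H$-free graph with independence number at most $f(n)$. Let $\overline{\rho\tau}(H,f)=\limsup_{n\to\infty}\mathbf{RT}(n,H,f(n))/n^2$ and $\underline{\rho\tau}(H,f)=\liminf_{n\to\infty}\mathbf{RT}(n,H,f(n))/n^2$; when they coincide, their common value is $\rho\tau(H,f)$. Further $\rho\tau(H,o(f)) := \lim_{\delta\to 0}\rho\tau(H,\delta f)$; an upper bound $\rho\tau(H,o(f))\le c$ means $\lim_{\delta\to0}\overline{\rho\tau}(H,\delta f)\le c$. The inverse Ramsey number $\mathbf{Q}(t,n)$ is the minimum independence number of a $K_t$-free graph on $n$ vertices. *)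

(* Defs.v *)
From HB Require Import structures.
From mathcomp Require Import all_boot all_order all_algebra.
From mathcomp Require Import all_classical all_reals all_analysis.

Set Implicit Arguments.
Unset Strict Implicit.
Unset Printing Implicit Defensive.

Import Order.TTheory GRing.Theory Num.Theory.
Import numFieldNormedType.Exports.

Local Open Scope ring_scope.

Record sgraph (V : finType) := SGraph {
  edges : {set {set V}};
  edgesP : [forall e in edges, #|e| == 2%N] }.

HB.instance Definition _ (V : finType) := [isSub for @edges V].
HB.instance Definition _ (V : finType) := [Finite of sgraph V by <:].

Definition adj (V : finType) (G : sgraph V) (x y : V) : bool :=
  [set x; y]%SET \in edges G.

Definition independent (V : finType) (G : sgraph V) (A : {set V}) : bool :=
  [forall x in A, forall y in A, ~~ adj G x y].

Definition indep_num (V : finType) (G : sgraph V) : nat :=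
  (\max_(A : {set V} | independent G A) #|A|)%N.

(* The copy of [H] in [G] need not be induced. *)
Definition contains (V W : finType) (H : sgraph W) (G : sgraph V) : bool :=
  [exists phi : {ffun W -> V},
     injectiveb phi &&
     [forall x, forall y, adj H x y ==> adj G (phi x) (phi y)]].

Definition graph_free (V W : finType) (H : sgraph W) (G : sgraph V) : bool :=
  ~~ contains H G.

Lemma complete_subproof (V : finType) :
  [forall e in [set e : {set V} | #|e| == 2%N]%SET, #|e| == 2%N].
Proof. by apply/forall_inP => e; rewrite inE. Qed.

Definition complete (V : finType) : sgraph V := SGraph (complete_subproof V).

Definition K (t : nat) : sgraph 'I_t := complete 'I_t.

(* The default value [n] of the minimum is harmless: no graph on [n] vertices
   has a larger independence number, and for [1 < t] the edgeless graph is
   [K t]-free with independence number [n]. *)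
Definition Q (t n : nat) : nat :=
  \big[minn/n]_(G : sgraph 'I_n | graph_free (K t) G) indep_num G.

Section RamseyTuran.
Variables (R : realType) (W : finType) (H : sgraph W).
Local Open Scope classical_set_scope.

(* The maximum is 0 when no graph satisfies the constraints. *)
Definition RT (n : nat) (a : R) : nat :=
  (\max_(G : sgraph 'I_n | graph_free H G && ((indep_num G)%:R <= a)%R)
     #|edges G|)%N.

Definition rhotau_sup (f : nat -> R) : \bar R :=
  limn_esup (fun n => ((RT n (f n))%:R / n%:R ^+ 2)%:E).

(* An upper bound on rho tau(H, o(f)) is by convention a bound on the limit of
   the upper densities; the limit is one-sided since delta is positive. *)
Definition rhotau_o_le (f : nat -> R) (c : R) : Prop :=
  let F (delta : R) := rhotau_sup (fun n => delta * f n) in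
  cvg (F delta @[delta --> 0^'+]) /\
  (lim (F delta @[delta --> 0^'+]) <= c%:E)%E.

End RamseyTuran.

(* Main.v *)
Require Import Defs.
From mathcomp Require Import all_boot all_order all_algebra.
From mathcomp Require Import boolp.
From mathcomp Require Import zify ring lra.

Set Implicit Arguments.
Unset Strict Implicit.
Unset Printing Implicit Defensive.

Import Order.TTheory GRing.Theory Num.Theory.

(** If [indep_num G <= delta * Q 4 n], then every linear-sized set of vertices
contains a [K_4]: otherwise disjoint copies of the graph induced on it would be
a [K_4]-free graph on [n] vertices with independence number below [Q 4 n].

Suppose that [G] has more than [(4/13 + gamma) n^2] edges. Start with [k]
copies of the whole vertex set and repeatedly split two of them along an
irregular pair, moving to a cell that is not too small and on which
[\sum (d + beta d^2)] over the pairwise densities [d] has increased. This ends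
with linear-sized sets [W_1, ..., W_k] that are pairwise lower regular and still
have average density above [8/13]. No partition of the graph is needed, and the
sets may overlap, since vertices of a clique are distinct anyway.

Let [q_ij] in [{0,...,4}] be the density of [(W_i, W_j)] in quarters, rounded
up. The sets are now processed one after the other. Among the four typical
vertices of a [K_4] found in the current candidates inside [W_i], one keeps [t]
whose common neighbourhood in each later [W_j] is still of linear size. This is
possible for every choice of [t] vertices when [t (5 - q_ij) <= 4], and for some
choice, by double counting, when [t <= q_ij]; hence one exceptional [j] of the
second kind can be afforded.

There remains a weighted Turan problem. Passing to a subset of the indices, every
weighted degree exceeds [8/13]. By averaging, for any weights [a] on the clusters
of a pattern some cluster [j] satisfies [\sum a_i q_ij > 32/13 \sum a_i]. Thus a
pattern cannot occur if all its extensions by such a [j] contain a 12-clique or a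
pattern excluded before; a list of 18 patterns, the last of which is a single
cluster, is excluded in this way. *)

(** * Levels and patterns *)

(* A [K_4] in a cluster has [t] vertices with large common neighbourhoods in
   later clusters joined to it by levels [qs]. *)
Definition admissible (t : nat) (qs : seq nat) : bool :=
  let b := [seq q <- qs | 4 < t * (5 - q)] in (size b <= 1) && all (leq t) b.

Definition take_size (qs : seq nat) : nat :=
  head 0 [seq t <- [:: 4; 3; 2; 1] | admissible t qs].

(* The size of the clique found by processing the clusters in the order of [S].
   A cluster with level 0 to a later one is skipped, since [take_size] is then 0. *)
Fixpoint yield (I : Type) (q : I -> I -> nat) (S : seq I) : nat :=
  if S is v :: S' then take_size [seq q v x | x <- S'] + yield q S' else 0.

Lemma take_size_admissible qs : admissible (take_size qs) qs.
Proof.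
have H0 : admissible 0 qs.
  rewrite /admissible; set b := filter _ _.
  have -> : b = [::] by rewrite /b; elim: qs {b} => //= q qs ->; rewrite mul0n.
  by [].
rewrite /take_size /=.
by do 4 (case: ifP => // _).
Qed.

Lemma take_size_le4 qs : take_size qs <= 4.
Proof. by rewrite /take_size /=; do 4 (case: ifP => // _). Qed.

(** Raising a level can only turn it from bad to good, so the filtered list shrinks and its
    remaining entries still dominate [t]. *)
Lemma admissible_mono (t : nat) (I : Type) (f g : I -> nat) (s : seq I) :
  (forall x, f x <= g x) -> admissible t (map f s) -> admissible t (map g s).
Proof.
move=> fg /andP[h1 h2]; apply/andP.
suff : (size [seq q <- map g s | 4 < t * (5 - q)]
         <= size [seq q <- map f s | 4 < t * (5 - q)]) /\
       all (leq t) [seq q <- map g s | 4 < t * (5 - q)].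
  by move=> [h3 h4]; split=> //; apply: leq_trans h1.
elim: s h2 {h1} => //= x s IHs; have fgx := fg x.
case: ifP => [hf /= /andP[tf h2]|hf h2].
  have [h3 h4] := IHs h2; case: ifP => hg //=.
    by rewrite h4 (leq_trans tf fgx).
  by split=> //; apply: leq_trans h3 _.
have [h3 h4] := IHs h2; case: ifP => hg //=.
by exfalso; move/negbT: hf; rewrite -leqNgt; nia.
Qed.

Lemma take_size_max t qs : t <= 4 -> admissible t qs -> t <= take_size qs.
Proof.
rewrite /take_size /=; case: t => [|[|[|[|[|]]]]] // _ h;
  by rewrite h; do ?case: ifP.
Qed.

Lemma take_size_mono (I : Type) (f g : I -> nat) (s : seq I) :
  (forall x, f x <= g x) -> take_size (map f s) <= take_size (map g s).
Proof.
move=> fg; apply: take_size_max (take_size_le4 _) _.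
exact: admissible_mono fg (take_size_admissible _).
Qed.

(* The rows of a strictly lower triangular matrix of levels. *)
Definition pattern := seq (seq nat).

(** The symmetric matrix with zero diagonal. Indices out of range also get level 0, which imposes no
    condition. *)
Definition entry (P : pattern) (i j : nat) : nat :=
  if j < i then nth 0 (nth [::] P i) j
  else if i < j then nth 0 (nth [::] P j) i else 0.

Fixpoint vectors (s : nat) : seq (seq nat) :=
  if s is s'.+1 then [seq x :: v | x <- iota 0 5, v <- vectors s'] else [:: [::]].

Definition dot (a v : seq nat) : nat := sumn [seq p.1 * p.2 | p <- zip a v].

Definition decr (v : seq nat) (i : nat) : seq nat := set_nth 0 v i (nth 0 v i).-1.

(** Only an initial segment of [idx] is read; as [idx] runs over all permutations, every placement
    of [P] inside [M] is tried. *)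
Definition dominates (M P : pattern) (idx : seq nat) : bool :=
  (size P <= size idx) &&
  all (fun i => all (fun j => entry P i j <= entry M (nth 0 idx i) (nth 0 idx j))
    (iota 0 i)) (iota 0 (size P)).

Definition forbidden (E : seq pattern) (M : pattern) (orders : seq (seq nat)) : bool :=
  has (fun idx => 12 <= yield (entry M) idx) orders
  || has (fun P => has (dominates M P) orders) E.

(* [thr < dot a v] is equivalent to [32 * sumn a < 13 * dot a v]. The middle
   disjunct leaves only the minimal such [v] to be examined. *)
Definition excluded (E : seq pattern) (P : pattern) (a : seq nat) : bool :=
  let thr := (32 * sumn a) %/ 13 in
  let orders := permutations (iota 0 (size P).+1) in
  [&& size P == size a, size P <= 5, 0 < sumn a &
    all (fun v => [|| dot a v <= thr,
        has (fun i => (0 < nth 0 v i) && (thr < dot a (decr v i))) (iota 0 (size v))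
      | forbidden E (rcons P v) orders]) (vectors (size P))].

Fixpoint excluded_in_turn (E : seq pattern) (L : seq (pattern * seq nat)) : bool :=
  if L is (P, a) :: L' then excluded E P a && excluded_in_turn (P :: E) L' else true.

(* Found by computer search. *)
Definition exclusion_list : seq (pattern * seq nat) :=
 [:: ([:: [::]; [:: 1]; [:: 2; 2]; [:: 4; 4; 4]], [:: 2; 2; 4; 5]);
     ([:: [::]; [:: 2]; [:: 4; 2]; [:: 2; 4; 4]], [:: 2; 2; 4; 5]);
     ([:: [::]; [:: 1]; [:: 3; 4]; [:: 4; 4; 2]], [:: 3; 3; 3; 4]);
     ([:: [::]; [:: 2]; [:: 4; 4]], [:: 4; 4; 5]);
     ([:: [::]; [:: 1]; [:: 2; 3]; [:: 4; 4; 3]], [:: 2; 4; 3; 5]);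
     ([:: [::]; [:: 1]; [:: 3; 3]; [:: 4; 4; 2]], [:: 5; 2; 5; 5]);
     ([:: [::]; [:: 1]; [:: 1; 1]; [:: 3; 3; 4]; [:: 4; 4; 4; 1]], [:: 4; 2; 1; 2; 4]);
     ([:: [::]; [:: 3]; [:: 4; 1]; [:: 1; 4; 4]], [:: 1; 2; 3; 5]);
     ([:: [::]; [:: 1]; [:: 4; 4]], [:: 4; 4; 5]);
     ([:: [::]; [:: 1]; [:: 3; 3]; [:: 3; 3; 4]], [:: 3; 1; 3; 3]);
     ([:: [::]; [:: 3]; [:: 3; 4]], [:: 2; 5; 4]);
     ([:: [::]; [:: 2]; [:: 3; 4]], [:: 4; 7; 7]);
     ([:: [::]; [:: 4]], [:: 5; 5]);
     ([:: [::]; [:: 2]; [:: 2; 3]; [:: 3; 3; 3]], [:: 4; 4; 4; 5]);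
     ([:: [::]; [:: 3]; [:: 3; 2]; [:: 2; 3; 3]], [:: 2; 2; 2; 3]);
     ([:: [::]; [:: 2]; [:: 3; 3]], [:: 6; 5; 6]);
     ([:: [::]; [:: 3]], [:: 5; 5]);
     ([:: [::]], [:: 1])].


Lemma exclusion_listP : excluded_in_turn [::] exclusion_list.
Proof. by lazy. Qed.

Lemma nth_le_sumn v i : nth 0 v i <= sumn v.
Proof. by elim: v i => [|x v IHv] [|i] //=; [exact: leq_addr|have := IHv i; lia]. Qed.

(** * Excluding patterns by weighted averaging *)

Section Patterns.
Variables (I : finType) (q : I -> I -> nat) (X : {set I}).
Hypothesis q_sym : forall i j, q i j = q j i.
Hypothesis q_le4 : forall i j, q i j <= 4.
Hypothesis heavy : forall i, i \in X -> 32 * #|X| < 13 * \sum_(j in X) q i j.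

Definition contains_pattern (P : pattern) (S : seq I) : Prop :=
  size S = size P /\
  forall x0 i j, j < i < size P -> entry P i j <= q (nth x0 S i) (nth x0 S j).

Lemma entryC P i j : entry P i j = entry P j i.
Proof. by rewrite /entry; case: ltngtP => // ->. Qed.

(** Averaging over [j] in [X]: by [heavy] and symmetry, each unit of weight contributes more than
    32/13 on average. *)
Lemma heavy_extension (S : seq I) (a : seq nat) :
  size a = size S -> 0 < sumn a -> {subset S <= X} ->
  exists2 j, j \in X & 32 * sumn a < 13 * dot a [seq q j x | x <- S].
Proof.
move=> sz a0 SX.
have key : 32 * sumn a * #|X| < 13 * \sum_(j in X) dot a [seq q j x | x <- S].
  elim: a S sz a0 SX => // b a IHa [|s S] //= [sz] a0 SX.
  have sX : s \in X by apply: SX; rewrite mem_head.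
  have SX' : {subset S <= X} by move=> x xS; apply: SX; rewrite inE xS orbT.
  have hs := heavy sX.
  have -> : \sum_(j in X) dot (b :: a) (q j s :: [seq q j x | x <- S])
     = b * (\sum_(j in X) q s j) + \sum_(j in X) dot a [seq q j x | x <- S].
    rewrite big_distrr /= -big_split /=; apply: eq_bigr => j _.
    by rewrite /dot /= (q_sym j s).
  have [a0'|a_pos] := posnP (sumn a).
    have b0 : 0 < b by lia.
    nia.
  have := IHa S sz a_pos SX'; nia.
apply/exists_inP; apply: contraLR key.
rewrite negb_exists_in -leqNgt => /forall_inP h.
rewrite big_distrr /= mulnC -sum_nat_const; apply: leq_sum => j jX.
by rewrite leqNgt h.
Qed.

Lemma yield_mono (J : Type) (f : J -> I) (p : J -> J -> nat) (s : seq J) :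
  (forall x y, p x y <= q (f x) (f y)) -> yield p s <= yield q (map f s).
Proof.
move=> pq; elim: s => //= v s IHs; rewrite leq_add // -map_comp.
by apply: take_size_mono => x /=.
Qed.

Lemma mem_vectors v : all (leq^~ 4) v -> v \in vectors (size v).
Proof.
elim: v => //= x v IHv /andP[x4 /IHv vv]; case: x x4 => [|[|[|[|[|]]]]] // _; by rewrite !mem_cat map_f ?orbT.
Qed.

Lemma contains_rcons P S j v :
  contains_pattern P S -> size v = size P ->
  (forall i, i < size S -> nth 0 v i <= q j (nth j S i)) ->
  contains_pattern (rcons P v) (rcons S j).
Proof.
move=> [sz h] szv hv; split; first by rewrite !size_rcons sz.
move=> x0 i k; rewrite size_rcons ltnS => /andP[ki]; rewrite leq_eqVlt => /orP[/eqP ei|iP].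
  have kS : k < size S by rewrite sz -ei.
  rewrite /entry ki !nth_rcons sz ei ltnn eqxx -sz kS.
  by rewrite (set_nth_default j) //; apply: hv.
have kP : k < size P := ltn_trans ki iP.
rewrite !nth_rcons sz iP kP; have := h x0 i k; rewrite ki iP => /(_ isT).
by rewrite /entry ki nth_rcons iP.
Qed.

Hypothesis poor : forall S : seq I, size S <= 6 -> yield q S < 12.

Lemma contains_entry P S x0 : contains_pattern P S ->
  forall i j, entry P i j <= q (nth x0 S i) (nth x0 S j).
Proof.
move=> [sz h].
have H i j : j <= i -> entry P i j <= q (nth x0 S i) (nth x0 S j).
  rewrite leq_eqVlt => /orP[/eqP->|ji]; first by rewrite /entry ltnn.
  have [iP|Pi] := ltnP i (size P); first by apply: h; rewrite ji.
  by rewrite /entry ji [nth [::] P i]nth_default // nth_default.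
move=> i j; have [ij|/ltnW ji] := leqP j i; first exact: H.
by rewrite entryC q_sym; exact: H.
Qed.

(** A heavy extension [j] of a copy of [P] has a row [v] above the threshold. Its entries are
    lowered, by induction on their sum, as long as it stays above; it remains a lower bound for the
    actual levels. The minimal row reached is one examined by [excluded], and yields either an order
    against [poor] or a pattern of [E]. *)
Lemma excludedP E P a S :
  (forall P' S', P' \in E -> {subset S' <= X} -> ~ contains_pattern P' S') ->
  excluded E P a -> {subset S <= X} -> ~ contains_pattern P S.
Proof.
move=> EF /and4P[/eqP sza szP a_pos /allP allv] SX PS.
have szS : size S = size P by case: PS.
have [j jX hv] := heavy_extension (etrans (esym sza) (esym szS)) a_pos SX.
set v := [seq q j x | x <- S] in hv.
have : size v = size P /\ (forall i, i < size S -> nth 0 v i <= q j (nth j S i)).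
  by split=> [|i iS]; rewrite ?size_map // (nth_map j).
have : (32 * sumn a) %/ 13 < dot a v by lia.
have [m] := ubnP (sumn v); elim: m v {hv} => // m IHm v vm av [szv vS].
have /allv : v \in vectors (size P).
  rewrite -szv; apply: mem_vectors; apply/(all_nthP 0) => i; rewrite szv -szS => iS.
  exact: leq_trans (vS i iS) (q_le4 _ _).
rewrite leqNgt av /=; case/orP.
  case/hasP => i; rewrite mem_iota add0n => iv /andP[vi0 adec].
  have szd : size (decr v i) = size v by rewrite size_set_nth; apply/maxn_idPr.
  apply: (IHm (decr v i)) => //.
    apply: leq_trans (vm : sumn v <= m).
    by rewrite sumn_set_nth_ltn //; have := nth_le_sumn v i; move: vi0 vm; lia.
  split=> [|k kS]; first by rewrite szd.
  rewrite nth_set_nth /=; case: eqP => [->|_]; last exact: vS.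
  by apply: leq_trans (leq_pred _) (vS _ _); rewrite szS -szv.
have cont := contains_rcons PS szv vS.
(* An index out of range gets the default [j], itself in [X]. *)
have sub idx : {subset map (nth j (rcons S j)) idx <= X}.
  move=> x /mapP[i _ ->]; have [iS|Si] := ltnP i (size (rcons S j)).
    have := mem_nth j iS; rewrite mem_rcons inE => /orP[/eqP->//|/SX]//.
  by rewrite nth_default.
have ent := contains_entry j cont.
case/orP => /hasP[].
  move=> idx; rewrite mem_permutations => /perm_size /=; rewrite size_iota => szi.
  apply/negP; rewrite -ltnNge; apply: leq_ltn_trans (yield_mono _ ent) _.
  by apply: poor; rewrite size_map szi ltnS.
move=> P' P'E /hasP[idx]; rewrite mem_permutations => /perm_size /=.
rewrite size_iota => szi /andP[szP' /allP dom].
apply: (EF P' (map (nth j (rcons S j)) (take (size P') idx)) P'E (sub _)).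
have szt : size (take (size P') idx) = size P' by rewrite size_takel.
split=> [|x0 i k /andP[ki iP]]; first by rewrite size_map szt.
have kP := ltn_trans ki iP.
rewrite !(nth_map 0) ?szt // !nth_take //.
have /dom/allP/(_ k) : i \in iota 0 (size P') by rewrite mem_iota.
rewrite mem_iota => /(_ ki) h; apply: leq_trans h _.
exact: ent.
Qed.

Lemma excluded_in_turnP E L :
  (forall P' S', P' \in E -> {subset S' <= X} -> ~ contains_pattern P' S') ->
  excluded_in_turn E L ->
  forall P S, P \in map fst L -> {subset S <= X} -> ~ contains_pattern P S.
Proof.
elim: L E => // -[P a] L IHL E EF /= /andP[exP exL].
have FP S : {subset S <= X} -> ~ contains_pattern P S by exact: excludedP exP.
move=> P' S; rewrite inE => /orP[/eqP->|P'L]; first exact: FP.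
apply: IHL exL _ _ P'L => P1 S1; rewrite inE => /orP[/eqP->|]; [exact: FP|exact: EF].
Qed.


End Patterns.

(** The last excluded pattern is one cluster without constraints, which any member of [X] realises.
    The bound 6 comes from patterns of at most 5 clusters plus one extension. *)
Lemma rich_sequence (I : finType) (q : I -> I -> nat) (X : {set I}) :
  (forall i j, q i j = q j i) -> (forall i j, q i j <= 4) -> X != set0 ->
  (forall i, i \in X -> 32 * #|X| < 13 * \sum_(j in X) q i j) ->
  exists2 S : seq I, size S <= 6 & 12 <= yield q S.
Proof.
move=> q_sym q_le4 /set0Pn[x xX] heavy; apply: contrapT => norich.
have poor S : size S <= 6 -> yield q S < 12.
  by move=> sz; rewrite ltnNge; apply/negP => yS; apply: norich; exists S.
have EF P' S' : P' \in [::] -> {subset S' <= X} -> ~ contains_pattern q P' S' by [].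
have none := excluded_in_turnP q_sym q_le4 heavy poor EF exclusion_listP.
apply: (none [:: [::]] [:: x]).
- by vm_compute.
- by move=> y; rewrite inE => /eqP->.
- by split=> // x0 [|i] j /andP[].
Qed.

(** Take a minimal [X] satisfying the density condition. Dropping [i] lowers |X|^2 + |X| by exactly
    2|X| and the double sum by twice the degree of [i], so this degree must be large. *)
Lemma min_degree_subset (I : finType) (q : I -> I -> nat) :
  (forall i j, q i j = q j i) -> (forall i, q i i = 0) ->
  32 * (#|I| ^ 2 + #|I|) < 13 * \sum_i \sum_j q i j ->
  exists2 X : {set I}, X != set0 &
    forall i, i \in X -> 32 * #|X| < 13 * \sum_(j in X) q i j.
Proof.
move=> q_sym q_irr dense.
pose f (X : {set I}) := 32 * (#|X| ^ 2 + #|X|) < 13 * \sum_(i in X) \sum_(j in X) q i j.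
have fT : f [set: I].
  rewrite /f cardsT; rewrite (eq_bigl xpredT) => [|i]; last by rewrite inE.
  by under eq_bigr => i _ do [rewrite (eq_bigl xpredT) => [|j]; last by rewrite inE].
have [X /minsetP[fX Xmin] _] := minset_exists fT.
exists X => [|i iX].
  by apply: contraTneq fX => ->; rewrite /f big_set0 cards0.
have : ~~ f (X :\ i).
  by apply/negP => /Xmin/(_ (subD1set _ _)) eX; move: iX; rewrite -eX !inE eqxx.
rewrite /f -leqNgt in fX *.
have := cardsD1 i X; rewrite iX.
rewrite (big_setD1 i iX) /= in fX.
have -> : \sum_(j in X) q i j = \sum_(j in X :\ i) q i j.
  by rewrite (big_setD1 i iX) /= q_irr.
move: fX.
rewrite (big_setD1 i iX) /= q_irr.
have -> : \sum_(k in X :\ i) \sum_(j in X) q k j =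
  \sum_(j in X :\ i) q i j + \sum_(k in X :\ i) \sum_(j in X :\ i) q k j.
  by rewrite -big_split /=; apply: eq_bigr => k _; rewrite (big_setD1 i iX) /= q_sym.
nia.
Qed.

(** * Densities and regularity *)

Local Open Scope ring_scope.

Section Densities.
Variables (R : realFieldType) (V : finType) (e : rel V).

Definition nbhd (x : V) (A : {set V}) : {set V} := [set y in A | e x y].

Definition edge_count (A B : {set V}) : nat := (\sum_(x in A) #|nbhd x B|)%N.

Definition density (A B : {set V}) : R :=
  (edge_count A B)%:R / (#|A|%:R * #|B|%:R).

Definition clique (A : {set V}) : Prop := {in A &, forall x y, x != y -> e x y}.

Definition common_nbhd (T U : {set V}) : {set V} :=
  [set y in U | [forall x in T, e x y]].

(** One side suffices: the embedding only needs that few vertices have too small a degree. *)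
Definition lower_regular (eps : R) (A B : {set V}) : Prop :=
  forall A' B' : {set V}, A' \subset A -> B' \subset B ->
  eps * #|A|%:R <= #|A'|%:R -> eps * #|B|%:R <= #|B'|%:R ->
  density A B - eps < density A' B'.

Lemma card_sum (U : {set V}) (P : pred V) : #|[set y in U | P y]| = (\sum_(y in U) P y)%N.
Proof.
rewrite -sum1_card (eq_bigl (fun y => (y \in U) && P y)); last by move=> y; rewrite inE.
by rewrite big_mkcondr; apply: eq_bigr => y _; case: (P y).
Qed.

(** Pointwise in [y] of [U]: unless [y] is a common neighbour, some member of [T] misses it. *)
Lemma card_common_nbhd (T U : {set V}) :
  (#|U| + \sum_(x in T) #|nbhd x U| <= #|common_nbhd T U| + #|T| * #|U|)%N.
Proof.
rewrite /common_nbhd card_sum; under eq_bigr => x _ do rewrite /nbhd card_sum.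
rewrite exchange_big /= -[in X in (X + _ <= _)%N]sum1_card mulnC -sum_nat_const.
rewrite -!big_split /=; apply: leq_sum => y _.
case: forall_inP => [h|]; last first.
  move=> /forall_inP; rewrite negb_forall_in => /exists_inP[x xT nexy].
  rewrite (bigD1 x) //= (negbTE nexy) add0n (cardD1 x) xT leq_add2l.
  rewrite -sum1_card [leqRHS](eq_bigl (fun i => (i \in T) && (i != x))).
    by apply: leq_sum => i _; case: (e i y).
  by move=> i; rewrite !inE andbC.
rewrite leq_add2l -sum1_card; apply: leq_sum => x _; by case: (e x y).
Qed.

Lemma card_common_nbhd_ge (T U : {set V}) (d : R) :
  (forall x, x \in T -> d * #|U|%:R <= #|nbhd x U|%:R) ->
  (1 - #|T|%:R * (1 - d)) * #|U|%:R <= #|common_nbhd T U|%:R.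
Proof.
move=> h; have := card_common_nbhd T U; rewrite -(ler_nat R) !natrD natrM natr_sum.
have : #|T|%:R * (d * #|U|%:R) <= \sum_(x in T) #|nbhd x U|%:R :> R.
  by rewrite mulr_natl -sumr_const; apply: ler_sum.
nra.
Qed.

Lemma exists_subset_card (K : {set V}) t : (t <= #|K|)%N ->
  exists2 T : {set V}, T \subset K & #|T| = t.
Proof.
move=> tK; exists [set x in take t (enum K)].
  by apply/subsetP => x; rewrite inE => /mem_take; rewrite mem_enum.
rewrite cardsE (card_uniqP _) ?take_uniq ?enum_uniq //.
by rewrite size_takel // -cardE.
Qed.

(* Double counting: a point of [U] seen by at least [t] vertices of [K] lies in
   the common neighbourhood of some [t]-subset, and there are at most 16 of them. *)
Lemma exists_common_nbhd (e_sym : symmetric e) (K U : {set V}) (t : nat) (d mu : R) :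
  #|K| = 4%N -> (0 < t <= 4)%N ->
  (forall x, x \in K -> d * #|U|%:R <= #|nbhd x U|%:R) ->
  t%:R - 1 + 4 * mu <= 4 * d ->
  exists T : {set V}, [/\ T \subset K, #|T| = t &
    mu / 16 * #|U|%:R <= #|common_nbhd T U|%:R].
Proof.
move=> K4 /andP[t0 t4] deg td.
have [T0 T0K T0t] : exists2 T : {set V}, T \subset K & #|T| = t.
  by apply: exists_subset_card; rewrite K4.
pose P (T : {set V}) := (T \subset K) && (#|T| == t).
have PT0 : P T0 by rewrite /P T0K T0t eqxx.
case: (arg_maxnP (fun T => #|common_nbhd T U|) PT0) => T /andP[TK /eqP Tt] Tmax.
exists T; split=> //.
(* Pointwise in [U]: a vertex with fewer than [t] neighbours in [K] contributes at most [t.-1]; any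
   other contributes at most 4 and is seen by a whole [t]-subset. *)
have count : (\sum_(x in K) #|nbhd x U| <= t.-1 * #|U| + 4 * (16 * #|common_nbhd T U|))%N.
  have le16 : (\sum_(T' | P T') #|common_nbhd T' U| <= 16 * #|common_nbhd T U|)%N.
    apply: leq_trans (_ : \sum_(T' | P T') #|common_nbhd T U| <= _)%N.
      by apply: leq_sum => T' /Tmax.
    rewrite sum_nat_const leq_mul2r; apply/orP; right.
    apply: leq_trans (_ : #|powerset K| <= _)%N; last by rewrite card_powerset K4.
    by apply/subset_leq_card/subsetP => T'; rewrite inE => /andP[].
  apply: leq_trans (leq_add (leqnn _) (leq_mul (leqnn 4) le16)).
  under eq_bigr => x _ do rewrite /nbhd card_sum.
  under [X in (_ <= _ + 4 * X)%N]eq_bigr => x _ do rewrite /common_nbhd card_sum.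
  rewrite exchange_big /= [X in (_ <= _ + 4 * X)%N]exchange_big /=.
  rewrite mulnC -sum_nat_const big_distrr /= -big_split /=.
  apply: leq_sum => y _; rewrite -card_sum.
  set N := [set _ in K | _].
  have N4 : (#|N| <= 4)%N.
    by rewrite -K4; apply/subset_leq_card/subsetP => x; rewrite inE => /andP[].
  have [tN|Nt] := leqP t #|N|; last by lia.
  have [T' T'N T't] := exists_subset_card tN.
  rewrite (bigD1 T') /=; last first.
    rewrite /P T't eqxx andbT; apply: subset_trans T'N _.
    by apply/subsetP => x; rewrite inE => /andP[].
  have -> : [forall x in T', e x y].
    by apply/forall_inP => x /(subsetP T'N); rewrite inE => /andP[].
  by lia.
move: count; rewrite -(ler_nat R) natrD !natrM natr_sum.
have : #|K|%:R * (d * #|U|%:R) <= \sum_(x in K) #|nbhd x U|%:R :> R.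
  by rewrite mulr_natl -sumr_const; apply: ler_sum.
have -> : t.-1%:R = t%:R - 1 :> R by rewrite -subn1 natrB.
rewrite K4; have := ler0n R #|U|; nra.
Qed.

(** Indices outside the bad list allow any [t] vertices of [K]. At most one index is bad, and [T] is
    chosen for it by double counting. *)
Lemma admissible_choice (e_sym : symmetric e) (I : eqType) (K : {set V})
    (U : I -> {set V}) (q : I -> nat) (S : seq I) (t : nat) (mu : R) :
  #|K| = 4%N -> (0 < t <= 4)%N -> 0 < mu ->
  admissible t [seq q j | j <- S] -> (forall j, q j <= 4)%N ->
  (forall j x, j \in S -> x \in K ->
     (((q j)%:R - 1) / 4 + mu) * #|U j|%:R <= #|nbhd x (U j)|%:R) ->
  exists T : {set V}, [/\ T \subset K, #|T| = t &
    forall j, j \in S -> mu / 16 * #|U j|%:R <= #|common_nbhd T (U j)|%:R].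
Proof.
move=> K4 t14 mu0 /andP[]; rewrite filter_map size_map all_map => sz1 alltq q4 deg.
(* Each vertex misses at most a fraction (5 - q)/4 - mu, so [t] vertices together miss at most 1 - t
   mu, hence at most 1 - mu. *)
have good (T : {set V}) j : T \subset K -> #|T| = t -> j \in S -> (t * (5 - q j) <= 4)%N ->
    mu / 16 * #|U j|%:R <= #|common_nbhd T (U j)|%:R.
  move=> TK Tt jS; rewrite -(ler_nat R) natrM natrB ?(leq_trans (q4 j)) // => tq.
  have := @card_common_nbhd_ge T (U j) (((q j)%:R - 1) / 4 + mu).
  move=> /(_ (fun x xT => deg j x jS (subsetP TK x xT))).
  apply: le_trans; apply: ler_wpM2r => //; rewrite Tt.
  have : 1 <= t%:R :> R by rewrite ler1n; case/andP: t14.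
  nra.
case eb : [seq j <- S | _] sz1 alltq => [|j0 [|//]] _.
  move=> _; have [T TK Tt] : exists2 T : {set V}, T \subset K & #|T| = t.
    by apply: exists_subset_card; rewrite K4; case/andP: t14.
  exists T; split=> // j jS; apply: good => //; rewrite leqNgt; apply/negP => bj.
  have : j \in [seq j <- S | preim q (fun i => (4 < t * (5 - i))%N) j] by rewrite mem_filter /= bj.
  by rewrite eb.
rewrite /= andbT => tq0.
have mem_bad j : (j \in S) && (4 < t * (5 - q j))%N = (j == j0).
  by rewrite andbC -mem_seq1 -eb mem_filter.
have /andP[j0S _] : (j0 \in S) && (4 < t * (5 - q j0))%N by rewrite mem_bad.
have [||T [TK Tt Tj0]] :=
  @exists_common_nbhd e_sym K (U j0) t (((q j0)%:R - 1) / 4 + mu) mu K4 t14.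
- by move=> x; apply: deg.
- by move: tq0; rewrite -(ler_nat R); lra.
exists T; split=> // j jS; have [->//|jj0] := eqVneq j j0.
by apply: good => //; rewrite leqNgt; apply: contraNN jj0 => bj; rewrite -mem_bad jS.
Qed.

(** * Embedding a clique into lower regular sets *)

Section Embedding.
Variables (e_sym : symmetric e) (e_irr : irreflexive e).
Variables (I : finType) (W : I -> {set V}) (q : I -> I -> nat) (mu eps : R).
Hypothesis mu01 : 0 < mu <= 1.
Hypothesis eps_pos : 0 < eps.
Hypothesis eps_mu : eps <= mu.
Hypothesis W0 : forall i, (0 < #|W i|)%N.
Hypothesis q_le4 : forall i j, (q i j <= 4)%N.
Hypothesis q_density : forall i j, (0 < q i j)%N ->
  ((q i j)%:R - 1) / 4 + 2 * mu <= density (W i) (W j) /\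
  lower_regular eps (W i) (W j).
Hypothesis has_K4 : forall i (A : {set V}), A \subset W i ->
  eps * #|W i|%:R <= #|A|%:R ->
  exists K : {set V}, [/\ K \subset A, #|K| = 4%N & clique K].

(** Were the atypical set [D] larger, regularity would apply to [D] and [B]; but their density is at
    most (q - 1)/4 + mu, below that of the clusters by at least [mu], hence by [eps]. *)
Lemma few_atypical i j (A B : {set V}) : (0 < q i j)%N ->
  A \subset W i -> B \subset W j -> eps * #|W j|%:R <= #|B|%:R ->
  #|[set x in A | #|nbhd x B|%:R < (((q i j)%:R - 1) / 4 + mu) * #|B|%:R]|%:R
    <= eps * #|W i|%:R.
Proof.
move=> /q_density[dW reg] AW BW Blarge; set D := [set x in A | _].
rewrite leNgt; apply/negP => Dlarge.
have DW : D \subset W i.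
  by apply: subset_trans AW; apply/subsetP => x; rewrite inE => /andP[].
have := reg D B DW BW (ltW Dlarge) Blarge.
have W_pos k : 0 < #|W k|%:R :> R by rewrite ltr0n.
have B0 : 0 < #|B|%:R :> R by apply: lt_le_trans Blarge; rewrite mulr_gt0.
have D0 : 0 < #|D|%:R :> R by apply: le_lt_trans Dlarge; rewrite mulr_ge0 // ltW.
apply/negP; rewrite -leNgt [leLHS]/density ler_pdivrMr ?mulr_gt0 // natr_sum.
apply: (@le_trans _ _ (\sum_(x in D) (((q i j)%:R - 1) / 4 + mu) * #|B|%:R)).
  by apply: ler_sum => x; rewrite inE => /andP[_ /ltW].
rewrite sumr_const -[leLHS]mulr_natl mulrCA; apply: ler_wpM2r.
  by rewrite mulr_ge0 // ltW.
by move: dW eps_mu; move: (density _ _) ((q i j)%:R) => dd qq; lra.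
Qed.

Lemma card_bigcup_seq (J : Type) (s : seq J) (F : J -> {set V}) :
  (#|\bigcup_(j <- s) F j| <= \sum_(j <- s) #|F j|)%N.
Proof.
elim: s => [|j s IHs]; first by rewrite !big_nil cards0.
rewrite !big_cons; apply: leq_trans (leq_card_setU _ _) _; exact: leq_add.
Qed.

(** Induction on the order, with [rho] a lower bound for the fraction of each cluster still
    available. A step multiplies it by [mu / 16] at worst, and the first hypothesis keeps it large
    enough to the end. *)
Lemma embed_clique (S : seq I) (rho : R) (U : I -> {set V}) :
  2 * (size S).+1%:R * eps <= (mu / 16) ^+ size S * rho ->
  (forall i, i \in S -> U i \subset W i /\ rho * #|W i|%:R <= #|U i|%:R) ->
  exists C : {set V}, [/\ clique C, #|C| = yield q S &
    forall x, x \in C -> exists2 i, i \in S & x \in U i].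
Proof.
elim: S rho U => [|v S IHS] rho U small large.
  exists set0; split=> [x y||x]; rewrite ?inE ?cards0 //.
have /andP[mu0 mu1] := mu01.
pose t := take_size [seq q v x | x <- S].
have kap : 0 < (mu / 16) ^+ size S <= 1.
  by rewrite exprn_gt0 ?exprn_ile1 //; lra.
have rho0 : 0 < rho.
  have : 0 < (mu / 16) ^+ size (v :: S) * rho by apply: lt_le_trans small; rewrite !mulr_gt0.
  by rewrite pmulr_rgt0 // exprn_gt0 //; lra.
have small' : 2 * (size S).+1%:R * eps <= (mu / 16) ^+ size S * (mu / 16 * rho).
  rewrite mulrA -exprSr; apply: le_trans small; rewrite -!mulrA ler_pM2l //.
  by rewrite ler_pM2r // ler_nat.
(* Room for [size S] exceptional sets of relative size [eps], with one more [eps] left so that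
   [has_K4] applies. *)
have rho_eps : (size S).+1%:R * eps <= rho.
  have : (mu / 16) ^+ size S * (mu / 16 * rho) <= 1 * (1 * rho).
    apply: ler_pM; [lra|nra|lra|]; apply: ler_wpM2r; lra.
  have : 0 < (size S).+1%:R * eps by rewrite mulr_gt0.
  move: small'; nra.
have [t0|t_pos] := posnP t.
  have [||C [Cc Cs CU]] := IHS rho U.
  - apply: le_trans small' _; apply: ler_wpM2l; [lra|nra].
  - by move=> i iS; apply: large; rewrite inE iS orbT.
  exists C; split=> //; first by rewrite /= -/t t0.
  by move=> x /CU[i iS xU]; exists i => //; rewrite inE iS orbT.
have t4 : (t <= 4)%N := take_size_le4 _.
have adm : admissible t [seq q v x | x <- S] := take_size_admissible _.
(* For positive [t] a level 0 is bad, since 4 < 5t, and admissibility would then demand t <= 0. *)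
have q_pos j : j \in S -> (0 < q v j)%N.
  move=> jS; rewrite lt0n; apply/eqP => q0; case/andP: adm => _ /allP /(_ 0%N).
  rewrite mem_filter leqn0 -q0 map_f // q0 andbT subn0.
  have -> : (4 < t * 5)%N by lia.
  by move=> /(_ isT)/eqP t0'; rewrite t0' in t_pos.
have [UvW Uv_large] := large v (mem_head _ _).
have US j : j \in S -> U j \subset W j /\ rho * #|W j|%:R <= #|U j|%:R.
  by move=> jS; apply: large; rewrite inE jS orbT.
pose bad j := [set x in U v | #|nbhd x (U j)|%:R < (((q v j)%:R - 1) / 4 + mu) * #|U j|%:R].
have Wge0 k : 0 < #|W k|%:R :> R by rewrite ltr0n.
have eps_rho : eps <= rho.
  apply: le_trans rho_eps; rewrite ler_peMl ?ler1n //; exact: ltW.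
have bad_small j : j \in S -> #|bad j|%:R <= eps * #|W v|%:R.
  move=> jS; have [UjW Uj_large] := US j jS; apply: few_atypical; rewrite ?q_pos //.
  by apply: le_trans Uj_large; rewrite ler_pM2r.
pose A := U v :\: \bigcup_(j <- S) bad j.
have A_large : eps * #|W v|%:R <= #|A|%:R.
  have : #|\bigcup_(j <- S) bad j|%:R <= (size S)%:R * (eps * #|W v|%:R) :> R.
    apply: le_trans (_ : (\sum_(j <- S) #|bad j|)%:R <= _); first by rewrite ler_nat card_bigcup_seq.
    apply: le_trans (_ : \sum_(j <- S) eps * #|W v|%:R <= _).
      by rewrite natr_sum big_seq [leRHS]big_seq; apply: ler_sum => j /bad_small.
    by rewrite big_const_seq count_predT iter_addr_0 mulr_natl.
  have : #|U v|%:R <= #|A|%:R + #|\bigcup_(j <- S) bad j|%:R :> R.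
    rewrite -natrD ler_nat -(cardsID (\bigcup_(j <- S) bad j) (U v)) addnC leq_add2l.
    exact/subset_leq_card/subsetIr.
  have := Wge0 v; move: rho_eps; rewrite -natr1; nra.
have [|K [KA K4 Kc]] := has_K4 _ A_large.
  by apply: subset_trans (subsetDl _ _) UvW.
have typical j x : j \in S -> x \in K ->
    (((q v j)%:R - 1) / 4 + mu) * #|U j|%:R <= #|nbhd x (U j)|%:R.
  move=> jS /(subsetP KA); rewrite inE => /andP[nbad xU].
  rewrite leNgt; apply: contraNN nbad => lt; rewrite (big_rem j) //= inE.
  by rewrite inE xU lt.
have t14 : (0 < t <= 4)%N by rewrite t_pos.
have [T [TK Tt TU]] := admissible_choice e_sym K4 t14 mu0 adm (q_le4 v) typical.
have [|C [Cc Cs CU]] := IHS (mu / 16 * rho) (fun j => common_nbhd T (U j)) small'.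
  move=> j jS; have [UjW Uj_large] := US j jS; split.
    by apply: subset_trans UjW; apply/subsetP => x; rewrite inE => /andP[].
  apply: le_trans (TU j jS); rewrite -mulrA ler_wpM2l //; lra.
(* [C] lies in common neighbourhoods of [T]. With [e_irr] this also makes the two disjoint, although
   the clusters may overlap. *)
have TC x y : x \in T -> y \in C -> e x y.
  by move=> xT /CU[i _]; rewrite inE => /andP[_ /forall_inP]; apply.
exists (T :|: C); split.
- move=> x y; rewrite !inE => /orP[xT|xC] /orP[yT|yC] xy.
  + by apply: Kc => //; apply: (subsetP TK).
  + exact: TC.
  + by rewrite e_sym; exact: TC.
  + exact: Cc.
- rewrite cardsU Tt Cs /= -/t (_ : T :&: C = set0) ?cards0 ?subn0 //.
  apply/setP => x; rewrite !inE; apply/negP => /andP[xT xC].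
  by have := TC x x xT xC; rewrite e_irr.
- move=> x; rewrite inE => /orP[xT|/CU[i iS]].
    exists v; first exact: mem_head.
    by have := subsetP KA _ (subsetP TK _ xT); rewrite inE => /andP[].
  by rewrite inE => /andP[xU _]; exists i => //; rewrite inE iS orbT.
Qed.

End Embedding.

End Densities.

(** * Splitting into cells and the potential increment *)

Section Regularity.
Variables (R : realFieldType) (V : finType) (e : rel V).
Hypothesis e_sym : symmetric e.
Local Notation density := (@density R V e).

Lemma edge_countC (A B : {set V}) : edge_count e A B = edge_count e B A.
Proof.
rewrite /edge_count /nbhd; under eq_bigr do rewrite card_sum.
under [RHS]eq_bigr do rewrite card_sum.
by rewrite exchange_big; apply: eq_bigr => y _; apply: eq_bigr => x _; rewrite e_sym.
Qed.

Lemma densityC (A B : {set V}) : density A B = density B A.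
Proof. by rewrite /density edge_countC [X in _ / X]mulrC. Qed.

Lemma density_ge0 (A B : {set V}) : 0 <= density A B.
Proof. by rewrite /density divr_ge0 ?mulr_ge0 ?ler0n. Qed.

Lemma density_le1 (A B : {set V}) : density A B <= 1.
Proof.
rewrite /density -natrM; have [->|AB0] := posnP (#|A| * #|B|)%N.
  by rewrite invr0 mulr0.
rewrite ler_pdivrMr ?ltr0n // mul1r ler_nat /edge_count -sum_nat_const.
by apply: leq_sum => x _; apply/subset_leq_card/subsetP => y; rewrite inE => /andP[].
Qed.

Lemma card_mul_density (A C : {set V}) :
  #|A|%:R * density A C = (edge_count e A C)%:R / #|C|%:R.
Proof.
have [A0|A0] := posnP #|A|.
  by rewrite (cards0_eq A0) cards0 mul0r /edge_count big_set0 mul0r.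
rewrite /density invfM mulrCA; congr (_ * _); rewrite mulrA divff ?mul1r //.
by rewrite pnatr_eq0 -lt0n.
Qed.

Lemma density_split (X A C : {set V}) : A \subset X -> (0 < #|X|)%N ->
  #|A|%:R / #|X|%:R * density A C + #|X :\: A|%:R / #|X|%:R * density (X :\: A) C
    = density X C.
Proof.
move=> AX X0; rewrite ![_ / #|X|%:R * _]mulrAC !card_mul_density -!mulrDl -natrD.
rewrite /density invfM [_^-1 * _]mulrC mulrA; congr (_%:R / _ / _).
by rewrite /edge_count [RHS](big_setID A) /= (setIidPr AX).
Qed.

Variables (I : finType).
Implicit Types W : I -> {set V}.

Definition update W i (A : {set V}) : I -> {set V} := fun l => if l == i then A else W l.

Lemma card_split (X A : {set V}) : A \subset X -> (0 < #|X|)%N ->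
  #|A|%:R / #|X|%:R + #|X :\: A|%:R / #|X|%:R = 1 :> R.
Proof.
move=> AX X0; rewrite -mulrDl -natrD.
have -> : (#|A| + #|X :\: A| = #|X|)%N by rewrite -(cardsID A X) (setIidPr AX).
rewrite divff //.
by rewrite pnatr_eq0 -lt0n.
Qed.

Lemma density_update W i (A : {set V}) l m : A \subset W i -> (0 < #|W i|)%N -> l != m ->
  #|A|%:R / #|W i|%:R * density (update W i A l) (update W i A m)
  + #|W i :\: A|%:R / #|W i|%:R *
      density (update W i (W i :\: A) l) (update W i (W i :\: A) m)
  = density (W l) (W m).
Proof.
move=> AW W0 lm; have W0' : #|W i|%:R != 0 :> R by rewrite pnatr_eq0 -lt0n.
rewrite /update; have [li|li] := eqVneq l i; have [mi|mi] := eqVneq m i.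
- by rewrite li mi eqxx in lm.
- by rewrite density_split // li.
- by rewrite ![density (W l) _]densityC density_split // mi.
- by rewrite -mulrDl card_split // mul1r.
Qed.

Section Cells.
Variables (W : I -> {set V}) (i j : I) (A B : {set V}) (beta : R).
Hypotheses (W0 : forall l, (0 < #|W l|)%N) (ij : i != j).
Hypotheses (AW : A \subset W i) (BW : B \subset W j) (beta0 : 0 <= beta).

Definition cell (a b : bool) : I -> {set V} :=
  update (update W i (if a then A else W i :\: A)) j (if b then B else W j :\: B).

Definition cell_weight (a b : bool) : R :=
  #|if a then A else W i :\: A|%:R / #|W i|%:R *
  (#|if b then B else W j :\: B|%:R / #|W j|%:R).

Definition cell_mean (f : bool -> bool -> R) : R :=
  cell_weight true true * f true true + cell_weight true false * f true false
  + cell_weight false true * f false true + cell_weight false false * f false false.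

Lemma cell_mean1 : cell_mean (fun _ _ => 1) = 1.
Proof.
rewrite /cell_mean /cell_weight !mulr1 -mulrDr card_split // -addrA -mulrDr card_split //.
by rewrite !mulr1 card_split.
Qed.

Lemma cell_mean_density l m : l != m ->
  cell_mean (fun a b => density (cell a b l) (cell a b m)) = density (W l) (W m).
Proof.
move=> lm; rewrite -(density_update AW (W0 i) lm) /cell_mean /cell_weight.
rewrite -![_ / _ * (_ / _) * _]mulrA -mulrDr -addrA -mulrDr /cell.
have split_j C := @density_update (update W i C) j B l m.
have Wj C : update W i C j = W j by rewrite /update eq_sym (negbTE ij).
by congr (_ * _ + _ * _); move: (split_j A) (split_j (W i :\: A));
  rewrite !Wj => hA hAc; rewrite ?hA ?hAc.
Qed.

(** The linear term keeps the total density from dropping; the quadratic term rises at an irregular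
    pair, and a small [beta] limits the error it introduces. *)
Definition potential W' : R :=
  \sum_(p : I * I | p.1 != p.2)
     (density (W' p.1) (W' p.2) + beta * density (W' p.1) (W' p.2) ^+ 2).

Lemma cell_weight_ge0 a b : 0 <= cell_weight a b.
Proof. by rewrite /cell_weight mulr_ge0 ?divr_ge0 ?ler0n. Qed.

Lemma cell_mean_convex l m : l != m ->
  density (W l) (W m) + beta * density (W l) (W m) ^+ 2
    + beta * (cell_weight true true *
        (density (cell true true l) (cell true true m) - density (W l) (W m)) ^+ 2)
  <= cell_mean (fun a b => density (cell a b l) (cell a b m)
                + beta * density (cell a b l) (cell a b m) ^+ 2).
Proof.
move=> lm; have := cell_mean_density lm; have := cell_mean1; rewrite /cell_mean.
have := (cell_weight_ge0 true false, cell_weight_ge0 false true, cell_weight_ge0 false false).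
set x := density (W l) (W m); set p := cell_weight true true.
set q := cell_weight true false; set r := cell_weight false true.
set s := cell_weight false false; set a := density (cell true true l) _.
set b := density (cell true false l) _; set c := density (cell false true l) _.
set d := density (cell false false l) _ => -[[q0 r0] s0] E1 Ex.
rewrite -subr_ge0.
have := @sqr_ge0 R (b - x); have := sqr_ge0 (c - x); have := sqr_ge0 (d - x).
move: E1 Ex; rewrite !mulr1 => E1 Ex d2 c2 b2.
(* As the weights sum to 1 and the mean is [x], what remains is [beta] times the variance over the
   three other cells. *)
have -> : p * (a + beta * a ^+ 2) + q * (b + beta * b ^+ 2) + r * (c + beta * c ^+ 2)
    + s * (d + beta * d ^+ 2)
    - (x + beta * x ^+ 2 + beta * (p * (a - x) ^+ 2))
  = beta * (q * (b - x) ^+ 2 + r * (c - x) ^+ 2 + s * (d - x) ^+ 2)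
    + (1 + 2 * beta * x) * (p * a + q * b + r * c + s * d - x)
    + (beta * x ^+ 2) * (1 - (p + q + r + s)) by ring.
by rewrite E1 Ex !subrr !mulr0 !addr0 mulr_ge0 // !addr_ge0 // mulr_ge0.
Qed.


(** Convexity applies to every pair of indices; the variance gain is kept at (i, j) alone. *)
Lemma cell_mean_potential :
  potential W + beta * (cell_weight true true * (density A B - density (W i) (W j)) ^+ 2)
  <= cell_mean (fun a b => potential (cell a b)).
Proof.
have -> : cell_mean (fun a b => potential (cell a b)) =
  \sum_(p : I * I | p.1 != p.2) cell_mean (fun a b =>
      density (cell a b p.1) (cell a b p.2)
      + beta * density (cell a b p.1) (cell a b p.2) ^+ 2).
  by rewrite /cell_mean /potential !big_distrr /= -!big_split.
rewrite /potential (bigD1 (i, j)) //= [leRHS](bigD1 (i, j)) //= addrAC.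
apply: lerD.
  have := cell_mean_convex ij.
  by rewrite /= /cell /update !eqxx (negbTE ij).
apply: ler_sum => -[l m] /= /andP[lm _]; apply: le_trans (cell_mean_convex lm).
rewrite lerDl mulr_ge0 ?beta0 // mulr_ge0 ?cell_weight_ge0 ?sqr_ge0 //.
Qed.

(** Otherwise each cell lighter than [tau] contributes at most [tau * M] and the others have values
    below x + eta/2, so the mean is at most 4 tau M + x + eta/2 < x + eta. *)
Lemma exists_cell (f : bool -> bool -> R) (x eta M tau : R) :
  (forall a b, f a b <= M) -> 0 <= M -> 0 <= x -> 0 < eta -> 0 < tau ->
  8 * (tau * M) < eta -> x + eta <= cell_mean f ->
  exists a, exists b, tau <= cell_weight a b /\ x + eta / 2 <= f a b.
Proof.
move=> fM M0 x0 eta0 tau0 small mean; apply: contrapT => none.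
have key a b : cell_weight a b * f a b <= tau * M + cell_weight a b * (x + eta / 2).
  have := cell_weight_ge0 a b => w0.
  have [wt|tw] := ltP (cell_weight a b) tau.
    have : cell_weight a b * f a b <= tau * M.
      apply: le_trans (ler_wpM2l w0 (fM a b)) _.
      by apply: ler_wpM2r => //; exact: ltW.
    have : 0 <= cell_weight a b * (x + eta / 2) by rewrite mulr_ge0 //; lra.
    lra.
  have [fx|xf] := ltP (f a b) (x + eta / 2); last by case: none; exists a, b.
  have : cell_weight a b * f a b <= cell_weight a b * (x + eta / 2).
    by apply: ler_wpM2l => //; exact: ltW.
  have : 0 <= tau * M by rewrite mulr_ge0 //; exact: ltW.
  lra.
have := cell_mean1; move: mean; rewrite /cell_mean.
have := (key true true, key true false, key false true, key false false).
rewrite !mulr1 => -[[[k1 k2] k3] k4] mean w1.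
have := congr1 ( *%R^~ (x + eta / 2)) w1; rewrite mul1r !mulrDl; lra.
Qed.

End Cells.

Lemma lower_regularPn (eps : R) (A B : {set V}) : ~ lower_regular e eps A B ->
  exists A' B' : {set V}, [/\ A' \subset A, B' \subset B, eps * #|A|%:R <= #|A'|%:R,
    eps * #|B|%:R <= #|B'|%:R & density A' B' <= density A B - eps].
Proof.
move=> nreg; apply: contrapT => none; apply: nreg => A' B' sA sB lA lB.
rewrite ltNge; apply/negP => le; apply: none; exists A', B'; split=> //.
Qed.

Lemma potential_ge0 beta W : 0 <= beta -> 0 <= potential beta W.
Proof.
move=> beta0; apply: sumr_ge0 => p _.
by apply: addr_ge0; [exact: density_ge0|apply: mulr_ge0; rewrite ?sqr_ge0].
Qed.

Lemma potential_le beta W : 0 <= beta <= 1 -> potential beta W <= 2 * #|I|%:R ^+ 2.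
Proof.
move=> /andP[beta0 beta1].
apply: le_trans (_ : \sum_(p : I * I | p.1 != p.2) 2 <= _).
  apply: ler_sum => p _; have := density_ge0 (W p.1) (W p.2).
  have := density_le1 (W p.1) (W p.2); move: (density _ _) => d; nra.
apply: le_trans (_ : \sum_(p : I * I) 2 <= _).
  by rewrite big_mkcond; apply: ler_sum => p _; case: ifP.
by rewrite sumr_const card_prod -[leLHS]mulr_natr natrM expr2.
Qed.

Lemma potential_increment (beta eps tau : R) W i j :
  0 < beta <= 1 -> 0 < eps -> 0 < tau ->
  16 * (tau * #|I|%:R ^+ 2) < beta * eps ^+ 4 ->
  (forall l, (0 < #|W l|)%N) -> i != j -> ~ lower_regular e eps (W i) (W j) ->
  exists W', (forall l, W' l \subset W l /\ tau * #|W l|%:R <= #|W' l|%:R) /\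
    potential beta W + beta * eps ^+ 4 / 2 <= potential beta W'.
Proof.
move=> /andP[beta0 beta1] eps0 tau0 small W0 ij /lower_regularPn.
move=> [A [B [AW BW lA lB low]]].
have Wp l : 0 < #|W l|%:R :> R by rewrite ltr0n.
have beta0' := ltW beta0.
(* The witnesses of irregularity have relative size at least [eps] in both sets and their density
   deviates by at least [eps]: weight and squared deviation give [eps ^+ 2] each. *)
have gain : beta * eps ^+ 4 <= beta * (cell_weight W i j A B true true *
    (density A B - density (W i) (W j)) ^+ 2).
  apply: ler_wpM2l => //; rewrite (_ : 4%N = 2 + 2)%N // exprD.
  apply: ler_pM; rewrite ?sqr_ge0 //.
    rewrite expr2 /cell_weight; apply: ler_pM; rewrite ?(ltW eps0) //.
      by rewrite ler_pdivlMr.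
    by rewrite ler_pdivlMr.
  by rewrite -[leRHS]sqrrN ler_pXn2r ?nnegrE //; lra.
have mean := le_trans (lerD (lexx _) gain) (cell_mean_potential W0 ij AW BW beta0').
have [|||||a [b [wt pot]]] := exists_cell W0 AW BW
    (M := 2 * #|I|%:R ^+ 2) _ _ _ _ tau0 _ mean.
- by move=> a b; apply: potential_le; rewrite beta0' beta1.
- by rewrite mulr_ge0 ?exprn_ge0 ?ler0n.
- exact: potential_ge0.
- by rewrite mulr_gt0 ?exprn_gt0.
- lra.
exists (cell W i j A B a b); split=> //.
have ratio_le1 (X Y : {set V}) : X \subset Y -> #|X|%:R / #|Y|%:R <= 1 :> R.
  move=> /subset_leq_card XY; have [->|Y0] := posnP #|Y|; first by rewrite invr0 mulr0.
  by rewrite ler_pdivrMr ?ltr0n // mul1r ler_nat.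
have sub (X Y : {set V}) (c : bool) : X \subset Y -> (if c then X else Y :\: X) \subset Y.
  by case: c => // _; apply: subsetDl.
have ratio_ge0 (X Y : {set V}) : 0 <= #|X|%:R / #|Y|%:R :> R by rewrite divr_ge0.
have := sub _ _ a AW; have := sub _ _ b BW; move: wt; rewrite /cell_weight.
rewrite /cell /update; set A1 := if a then _ else _; set B1 := if b then _ else _.
move=> wt BW1 AW1 l.
have rA := ratio_le1 _ _ AW1; have rB := ratio_le1 _ _ BW1.
have rA0 := ratio_ge0 A1 (W i); have rB0 := ratio_ge0 B1 (W j).
(* [tau] is at most a product of two ratios in [0,1], hence at most each of them, as required at [i]
   and [j]. *)
have tau1 : tau <= 1 by nra.
have [->|lj] := eqVneq l j; first by split=> //; rewrite -ler_pdivlMr //; nra.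
have [->|li] := eqVneq l i; first by split=> //; rewrite -ler_pdivlMr //; nra.
by split=> //; rewrite ler_piMl.
Qed.

End Regularity.

(** An irregular pair allows a gain [eta] in a potential bounded by [2 * #|I|%:R ^+ 2], so splitting
    stops within [n] rounds, each costing a factor [tau] in size. *)
Lemma regular_cylinder (R : archiRealFieldType) (I : finType) (beta eps : R) :
  0 < beta <= 1 -> 0 < eps <= 1 ->
  exists2 c : R, 0 < c &
  forall (V : finType) (e : rel V) (W : I -> {set V}), symmetric e ->
  (forall l, (0 < #|W l|)%N) ->
  exists W' : I -> {set V},
    [/\ forall l, W' l \subset W l /\ c * #|W l|%:R <= #|W' l|%:R,
        forall l m, l != m -> lower_regular e eps (W' l) (W' m) &
        \sum_(p : I * I | p.1 != p.2) density R e (W p.1) (W p.2) <=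
        \sum_(p : I * I | p.1 != p.2) density R e (W' p.1) (W' p.2)
        + beta * #|I|%:R ^+ 2].
Proof.
move=> beta01 /andP[eps0 eps1]; have /andP[beta0 beta1] := beta01.
pose eta := beta * eps ^+ 4 / 2.
have eta0 : 0 < eta by rewrite divr_gt0 // mulr_gt0 // exprn_gt0.
pose tau := eta / (16 * #|I|%:R ^+ 2 + 1).
have den0 : 0 < 16 * #|I|%:R ^+ 2 + 1 :> R.
  by rewrite ltr_wpDl // mulr_ge0 ?exprn_ge0.
have tau0 : 0 < tau by rewrite divr_gt0.
have tau1 : tau <= 1.
  rewrite ler_pdivrMr // mul1r.
  have e4 : eps ^+ 4 <= 1 by rewrite exprn_ile1 // ltW.
  have : 0 <= #|I|%:R ^+ 2 :> R by rewrite exprn_ge0.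
  have : beta * eps ^+ 4 <= 1 by rewrite mulr_ile1 ?exprn_ge0 // ltW.
  rewrite /eta; lra.
have small : 16 * (tau * #|I|%:R ^+ 2) < beta * eps ^+ 4.
  have -> : beta * eps ^+ 4 = 2 * eta by rewrite /eta; field.
  have : tau * (16 * #|I|%:R ^+ 2 + 1) = eta by rewrite /tau divfK // gt_eqF.
  lra.
pose n := (Num.truncn (2 * #|I|%:R ^+ 2 / eta)).+1.
exists (tau ^+ n); first by rewrite exprn_gt0.
move=> V e W e_sym W0.
have iter m : exists W' : I -> {set V},
   [/\ forall l, W' l \subset W l /\ tau ^+ m * #|W l|%:R <= #|W' l|%:R,
       potential e beta W <= potential e beta W' &
       (forall l m, l != m -> lower_regular e eps (W' l) (W' m)) \/
       m%:R * eta <= potential e beta W'].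
  elim: m => [|m [W' [sub pot]]].
    exists W; split=> // [l|]; first by rewrite expr0 mul1r.
    by right; rewrite mul0r potential_ge0 // ltW.
  have [reg|nreg] := pselect (forall l m, l != m -> lower_regular e eps (W' l) (W' m)).
    exists W'; split=> // [l|]; last by left.
    have [sl cl] := sub l; split=> //; apply: le_trans cl; rewrite exprS.
    by rewrite ler_wpM2r // ler_piMl ?exprn_ge0 ?(ltW tau0).
  case=> // big; have /existsNP[i /existsNP[j /not_implyP[ij nreg_ij]]] := nreg.
  have W'0 l : (0 < #|W' l|)%N.
    rewrite -(ltr0n R); apply: lt_le_trans (sub l).2.
    by rewrite mulr_gt0 ?exprn_gt0 ?ltr0n.
  have [W2 [sub2 pot2]] := potential_increment e_sym beta01 eps0 tau0 small W'0 ij nreg_ij.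
  exists W2; split=> [l||].
  - have [s1 c1] := sub l; have [s2 c2] := sub2 l; split; first exact: subset_trans s1.
    by apply: le_trans c2; rewrite exprS -mulrA ler_pM2l.
  - by apply: le_trans pot _; apply: le_trans pot2; rewrite lerDl ltW.
  - by right; rewrite -natr1 mulrDl mul1r; apply: le_trans pot2; rewrite lerD2r.
have [W' [sub pot reg]] := iter n.
exists W'; split=> //.
  case: reg => // big; exfalso.
  have le2 : potential e beta W' <= 2 * #|I|%:R ^+ 2 by rewrite potential_le ?(ltW beta0).
  have := truncnS_gt (2 * #|I|%:R ^+ 2 / eta); rewrite ltr_pdivrMr // -/n.
  by rewrite ltNge (le_trans big le2).
(* Dropping the quadratic terms at the end loses at most [beta] per pair. *)
apply: le_trans (le_trans _ pot) _.
  by apply: ler_sum => p _; rewrite lerDl mulr_ge0 ?sqr_ge0 // ltW.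
rewrite /potential big_split /= lerD2l -big_distrr /= ler_wpM2l ?(ltW beta0) //.
apply: le_trans (_ : \sum_(p : I * I) 1 <= _); last first.
  by rewrite sumr_const card_prod natrM expr2.
rewrite big_mkcond; apply: ler_sum => p _; case: ifP => // _.
by rewrite exprn_ile1 ?density_ge0 ?density_le1.
Qed.

(** * Graphs with small independence number *)

From mathcomp Require Import all_classical all_reals all_analysis.
Import numFieldNormedType.Exports.

Section Graphs.
Variables (V : finType).
Implicit Types G : sgraph V.

Lemma adj_sym G : symmetric (adj G).
Proof. by move=> x y; rewrite /adj finset.setUC. Qed.

Lemma adj_irr G : irreflexive (adj G).
Proof.
move=> x; apply/negbTE/negP => xx; have /forall_inP/(_ _ xx) := edgesP G.
by rewrite cards2 eqxx.
Qed.

Lemma adj_K t (i j : 'I_t) : adj (K t) i j = (i != j).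
Proof. by rewrite /adj /= inE cards2; case: (i == j). Qed.

Lemma contains_K t G (C : {set V}) : clique (adj G) C -> (t <= #|C|)%N ->
  contains (K t) G.
Proof.
move=> Cc tC; have [T TC Tt] := exists_subset_card tC.
pose phi : {ffun 'I_t -> V} := [ffun i => enum_val (cast_ord (esym Tt) i)].
have phi_inj : injective phi.
  by move=> i j; rewrite !ffunE => /enum_val_inj/cast_ord_inj.
apply/existsP; exists phi; rewrite (introT (injectiveP _) phi_inj) /=.
apply/forallP => i; apply/forallP => j; apply/implyP; rewrite adj_K => ij.
by apply: Cc; rewrite ?(inj_eq phi_inj) // ffunE; apply/(fintype.subsetP TC)/enum_valP.
Qed.

Lemma K_clique t G : contains (K t) G ->
  exists2 C : {set V}, clique (adj G) C & #|C| = t.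
Proof.
move=> /existsP[phi /andP[/injectiveP phi_inj /forallP hphi]].
exists (phi @: [set: 'I_t])%SET; last by rewrite card_imset // cardsT card_ord.
move=> _ _ /imsetP[i _ ->] /imsetP[j _ ->] ij.
have /forallP/(_ j)/implyP := hphi i; apply; rewrite adj_K.
by apply: contraNN ij => /eqP->.
Qed.

(** Every edge comes from two distinct ordered pairs of adjacent vertices. *)
Lemma two_mul_edges G : (2 * #|edges G| <= edge_count (adj G) [set: V]%SET [set: V]%SET)%N.
Proof.
rewrite /edge_count.
under eq_bigr => x _ do rewrite /nbhd card_sum.
have sumT (F : V -> nat) : (\sum_(x in [set: V]%SET) F x = \sum_x F x)%N.
  by apply: eq_bigl => x; rewrite finset.in_setT.
rewrite sumT; under eq_bigr => x _ do rewrite sumT.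
rewrite pair_big /= mulnC -sum_nat_const.
rewrite [leqRHS](_ : _ = \sum_(p : V * V | [set p.1; p.2]%SET \in edges G) 1)%N; last first.
  by rewrite [RHS]big_mkcond; apply: eq_bigr => -[x y] _ /=; rewrite /adj; case: ifP.
rewrite (partition_big (fun p : V * V => [set p.1; p.2]%SET) (mem (edges G))) //=.
apply: leq_sum => E EG; have /cards2P[x [y [xy EE]]] := forall_inP (edgesP G) E EG.
rewrite (bigD1 (x, y)) /=; last by rewrite -EE EG eqxx.
rewrite (bigD1 (y, x)) /=; last first.
  by rewrite finset.setUC -EE EG eqxx xpair_eqE eq_sym (negbTE xy).
by rewrite addnA leq_addr.
Qed.

Lemma indep_num_ge1 G : (0 < #|V|)%N -> (0 < indep_num G)%N.
Proof.
move=> /card_gt0P[x _]; apply: leq_trans (_ : #|[set x]%SET| <= _)%N; first by rewrite cards1.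
apply: (@leq_bigmax_cond _ (independent G) (fun A : {set V} => #|A|)).
apply/forall_inP => y; rewrite inE => /eqP->; apply/forall_inP => z.
by rewrite inE => /eqP->; rewrite adj_irr.
Qed.

Variable r : rel V.
Hypotheses (r_sym : symmetric r) (r_irr : irreflexive r).

Lemma sgraph_of_subproof :
  [forall e in [set e : {set V} | (#|e| == 2%N) &&
      [forall x in e, forall y in e, (x != y) ==> r x y]]%SET, #|e| == 2%N].
Proof. by apply/forall_inP => e; rewrite inE => /andP[]. Qed.

Definition sgraph_of : sgraph V := SGraph sgraph_of_subproof.

Lemma adj_sgraph_of x y : adj sgraph_of x y = r x y.
Proof.
rewrite /adj inE cards2; have [->|xy] /= := eqVneq x y; first by rewrite r_irr.
apply/forall_inP/idP => [/(_ x)|rxy].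
  rewrite finset.set21 => /(_ isT)/forall_inP/(_ y).
  by rewrite finset.set22 => /(_ isT)/implyP; apply.
move=> _ /set2P[]->; apply/forall_inP => _ /set2P[]->; apply/implyP => //.
- by rewrite eqxx.
- by rewrite r_sym.
- by rewrite eqxx.
Qed.

End Graphs.

Lemma Q_le t n (G : sgraph 'I_n) : graph_free (K t) G -> (Q t n <= indep_num G)%N.
Proof.
move=> free; rewrite /Q; have : G \in index_enum (sgraph 'I_n) := mem_index_enum G.
elim: (index_enum _) => // G' s IHs; rewrite inE big_cons => /orP[/eqP<-|/IHs le].
  by rewrite free geq_minl.
by case: ifP => // _; apply: leq_trans le; rewrite geq_minr.
Qed.

Lemma Q_gt0 t n : (0 < n)%N -> (0 < Q t n)%N.
Proof.
move=> n0; rewrite /Q; elim/big_ind: _ => // [a b a0 b0|G _].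
  by rewrite leq_min a0.
by apply: indep_num_ge1; rewrite card_ord.
Qed.

Lemma leq_indep_num (V : finType) (G : sgraph V) (A : {set V}) :
  independent G A -> (#|A| <= indep_num G)%N.
Proof. exact: (@leq_bigmax_cond _ (independent G) (fun A : {set V} => #|A|)). Qed.

(* Disjoint copies of [G[A]] form a [K_t]-free graph on [n] vertices. *)
Lemma Q_le_of_K_free (n M t : nat) (G : sgraph 'I_n) (A : {set 'I_n}) :
  (0 < n <= M * #|A|)%N ->
  (forall C : {set 'I_n}, C \subset A -> clique (adj G) C -> #|C| != t) ->
  (Q t n <= M * indep_num G)%N.
Proof.
move=> /andP[n0 nMA] free.
have A0 : (0 < #|A|)%N by move: n0 nMA; case: #|A| => //; rewrite muln0; lia.
have [x0 _] := card_gt0P A0.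
(* The vertices are cut into blocks of length [#|A|], the last possibly shorter; [w x] is the vertex
   of [A] that [x] copies. *)
pose w (x : 'I_n) := nth x0 (enum A) (x %% #|A|).
have wA x : w x \in A by rewrite -mem_enum mem_nth // -cardE ltn_mod.
have w_inj (x y : 'I_n) : (x %/ #|A| = y %/ #|A|)%N -> w x = w y -> x = y.
  move=> xy /eqP; rewrite nth_uniq ?enum_uniq -?cardE ?ltn_mod // => /eqP xy'.
  by apply: val_inj; rewrite /= (divn_eq x #|A|) (divn_eq y #|A|) xy xy'.
pose r := [rel x y : 'I_n | (x %/ #|A| == y %/ #|A|)%N && adj G (w x) (w y)].
have r_sym : symmetric r by move=> x y; rewrite /= eq_sym adj_sym.
have r_irr : irreflexive r by move=> x; rewrite /= adj_irr andbF.
apply: leq_trans (Q_le (G := sgraph_of r) _) _.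
  (* A clique of [r] lies in one block, so [w] maps it injectively onto a clique inside [A]. *)
  apply/negP => /K_clique[C Cc Ct].
  have Cr : {in C &, forall x y, x != y -> r x y}.
    by move=> x y xC yC /(Cc x y xC yC); rewrite (adj_sgraph_of r_sym r_irr).
  have wCinj : {in C &, injective w}.
    move=> x y xC yC wxy; apply/eqP; rewrite -[_ == _]negbK; apply/negP => xy.
    by have /andP[_] := Cr x y xC yC xy; rewrite wxy adj_irr.
  suff : #|(w @: C)%SET| != t by rewrite card_in_imset // Ct eqxx.
  apply: free.
  - by apply/fintype.subsetP => _ /imsetP[x _ ->].
  - move=> _ _ /imsetP[x xC ->] /imsetP[y yC ->] wxy.
    have xy : x != y by apply: contraNN wxy => /eqP->.
    by have /andP[] := Cr x y xC yC xy.
(* An independent set meets each of at most [M] blocks in a copy of an independent set of [G]. *)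
apply/bigmax_leqP => S /forall_inP indS.
pose block (b : 'I_M) := [set x in S | (x %/ #|A| == b)%N]%SET.
have -> : #|S| = (\sum_(b < M) #|block b|)%N.
  have xM (x : 'I_n) : (x %/ #|A| < M)%N.
    by rewrite ltn_divLR //; apply: leq_trans nMA.
  rewrite -[LHS]sum1_card (partition_big (fun x => Ordinal (xM x)) xpredT) //=.
  by apply: eq_bigr => b _; rewrite -[RHS]sum1_card; apply: eq_bigl => x; rewrite inE.
rewrite -[M in leqRHS]card_ord -sum_nat_const; apply: leq_sum => b _.
have winj : {in block b &, injective w}.
  move=> x y; rewrite !inE => /andP[_ /eqP xb] /andP[_ /eqP yb]; apply: w_inj.
  by rewrite xb yb.
rewrite -(card_in_imset winj); apply: leq_indep_num.
apply/forall_inP => _ /imsetP[x xb ->]; apply/forall_inP => _ /imsetP[y yb ->].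
move: xb yb; rewrite !inE => /andP[xS /eqP xb] /andP[yS /eqP yb].
have /forall_inP/(_ y yS) := indS x xS.
by rewrite (adj_sgraph_of r_sym r_irr) /= xb yb eqxx.
Qed.

(* The density [d] in quarters, rounded up with a margin [th]. *)
Definition level (R : realFieldType) (th d : R) : nat :=
  ((th < d)%R + (1 / 4 + th < d)%R + (1 / 2 + th < d)%R + (3 / 4 + th < d)%R)%N.

Section Level.
Variables (R : realFieldType) (th d : R).

Lemma level_le4 : (level th d <= 4)%N.
Proof. by rewrite /level; do 4 case: (_ < _)%R. Qed.

Lemma level_gt0 : (0 < level th d)%N -> ((level th d)%:R - 1) / 4 + th <= d.
Proof.
by rewrite /level; do 4 case: ltP => ?; rewrite ?addn0 ?add0n //= => _; lra.
Qed.

Lemma le_level : 0 <= th -> d <= 1 -> d - th <= (level th d)%:R / 4.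
Proof.
by rewrite /level; do 4 case: ltP => ?; rewrite ?addn0 ?add0n //= => ? ?; lra.
Qed.

End Level.

(** * From levels to the edge bound *)

(** The excess 2g per pair pays for the rounding margin, g/2 per pair, for the loss g k^2/4 and,
    since g k >= 4, for all terms linear in [k]. *)
Lemma dense_levels (R : realFieldType) (k : nat) (g : R) (d : 'I_k -> 'I_k -> R) :
  0 < g <= 1 -> 4 <= g * k%:R ->
  (forall i j, d i j <= 1) ->
  k%:R * (k%:R - 1) * (8 / 13 + 2 * g) <=
    \sum_(p : 'I_k * 'I_k | p.1 != p.2) d p.1 p.2 + g / 4 * k%:R ^+ 2 ->
  (32 * (k ^ 2 + k) <
    13 * \sum_i \sum_j (if i == j then 0 else level (g / 2) (d i j)))%N.
Proof.
move=> /andP[g0 g1] gk d1 dense; rewrite -(ltr_nat R) !natrM natrD natrX.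
have -> : (\sum_(i : 'I_k) \sum_j (if i == j then 0 else level (g / 2) (d i j)))%:R =
    \sum_(p : 'I_k * 'I_k | p.1 != p.2) (level (g / 2) (d p.1 p.2))%:R :> R.
  rewrite pair_big natr_sum [RHS]big_mkcond; apply: eq_bigr => -[i j] _ /=.
  by case: eqP.
have : \sum_(p : 'I_k * 'I_k | p.1 != p.2) (d p.1 p.2 - g / 2) <=
    \sum_(p : 'I_k * 'I_k | p.1 != p.2) (level (g / 2) (d p.1 p.2))%:R / 4.
  by apply: ler_sum => p _; apply: le_level => //; lra.
rewrite -big_distrl /= big_split /= sumr_const.
set m := #|_|; set L := \sum_(_ | _) _%:R.
have : m%:R <= k%:R ^+ 2 :> R.
  rewrite -natrX ler_nat /m (leq_trans (max_card _)) //.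
  by rewrite card_prod card_ord expnS expn1.
rewrite -[- (g / 2) *+ _]mulr_natr; move: dense; set D := \sum_(_ | _) d _ _.
move: L D (m%:R) => L D mr dense mk hL.
have : 0 <= k%:R :> R by [].
move: (k%:R) gk dense mk => kr gk dense mk k0.
have mg : mr * g <= kr ^+ 2 * g by rewrite ler_wpM2r // ltW.
have kr0 : 0 < kr by nra.
have gkk : 4 * kr <= g * kr * kr by rewrite ler_wpM2r.
have gk1 : g * kr <= kr by rewrite ler_piMl.
nra.
Qed.

Lemma sum_offdiag (R : realFieldType) (k : nat) (x : R) :
  \sum_(p : 'I_k * 'I_k | p.1 != p.2) x = k%:R * (k%:R - 1) * x.
Proof.
rewrite -(pair_big_dep xpredT (fun i j : 'I_k => i != j) (fun _ _ => x)) /=.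
rewrite (eq_bigr (fun=> (k%:R - 1) * x)) => [|i _].
  by rewrite sumr_const card_ord -[LHS]mulr_natl mulrA.
rewrite sumr_const -[LHS]mulr_natl; congr (_ * _).
have -> : #|[pred j | i != j]| = k.-1.
  by rewrite -[k in RHS]card_ord -(cardC1 i); apply: eq_card => j; rewrite !inE eq_sym.
by case: k i => [[]|k i] //=; rewrite -natr1 addrK.
Qed.

Lemma linear_part_multiple (R : realType) (c eps : R) : 0 < c * eps ->
  exists2 M : nat, (0 < M)%N & forall n a : nat, c * eps * n%:R <= a%:R -> (n <= M * a)%N.
Proof.
move=> ce0; exists (Num.truncn (c * eps)^-1).+1 => // n a na.
have := truncnS_gt (c * eps)^-1; set M := (_.+1) => ltM.
rewrite -(ler_nat R) natrM.
have : n%:R <= (c * eps)^-1 * a%:R by rewrite mulrC ler_pdivlMr // mulrC.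
move=> h; apply: le_trans h _; apply: ler_wpM2r => //; exact: ltW.
Qed.

Lemma edge_bound (R : realType) (gamma : R) : 0 < gamma ->
  exists delta : R, 0 < delta /\
  exists N : nat, forall n : nat, (N <= n)%N ->
  forall G : sgraph 'I_n,
    graph_free (K 12) G ->
    (indep_num G)%:R <= delta * (Q 4 n)%:R ->
    (#|edges G|)%:R <= (4 / 13 + gamma) * n%:R ^+ 2.
Proof.
move=> gamma0; pose g : R := Num.min gamma 1.
have g0 : 0 < g by rewrite lt_min gamma0 ltr01.
have g1 : g <= 1 by rewrite ge_min lexx orbT.
have g_gamma : g <= gamma by rewrite ge_min lexx.
(* Taken as [beta], this gives the loss g k^2/4 allowed in [dense_levels]; the level margin [g / 2]
   is then the [2 * mu] of the embedding. *)
pose mu := g / 4.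
have mu01 : 0 < mu <= 1 by rewrite /mu; apply/andP; split; lra.
have /andP[mu0 mu1] := mu01.
(* With at most 6 clusters and [rho] equal to 1, [embed_clique] needs 2 * 7 * eps <= (mu/16)^6. *)
pose eps : R := (mu / 16) ^+ 6 / 14.
have kap1 : mu / 16 <= 1 by lra.
have kap0 : 0 < mu / 16 by lra.
have pow0 : 0 < (mu / 16) ^+ 6 by rewrite exprn_gt0.
have pow1 : (mu / 16) ^+ 6 <= mu / 16.
  by rewrite exprS ler_piMr ?exprn_ile1 // ltW.
have eps0 : 0 < eps by rewrite divr_gt0.
have eps_mu : eps <= mu by rewrite /eps; lra.
have eps1 : eps <= 1 by lra.
pose k := (Num.truncn (4 / g)).+1.
have gk : 4 <= g * k%:R.
  have := truncnS_gt (4 / g); rewrite -/k ltr_pdivrMr // mulrC => /ltW //.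
have eps01 : 0 < eps <= 1 by rewrite eps0.
have [c c0 regular] := regular_cylinder 'I_k mu01 eps01.
have ce0 : 0 < c * eps by rewrite mulr_gt0.
have [M M0 large] := linear_part_multiple ce0.
(* The successor makes M delta < 1, so M times the independence number is strictly below [Q 4 n]; a
   large set without a [K_4] would contradict this. *)
exists (M.+1%:R^-1); split; first by rewrite invr_gt0.
exists 1%N => n n0 G free alpha; rewrite leNgt; apply/negP => many.
have nR : 0 < n%:R :> R by rewrite ltr0n.
have cardT : #|[set: 'I_n]%SET| = n by rewrite cardsT card_ord.
have [|W [sub reg dens]] :=
    regular 'I_n (adj G) (fun _ => [set: 'I_n]%SET) (@adj_sym _ G).
  by move=> _; rewrite cardT.
have W_large i : c * n%:R <= #|W i|%:R by have := (sub i).2; rewrite cardT.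
have W0 i : (0 < #|W i|)%N.
  by rewrite -(ltr0n R); apply: lt_le_trans (W_large i); rewrite mulr_gt0.
pose q (i j : 'I_k) := if i == j then 0%N else level (g / 2) (density R (adj G) (W i) (W j)).
have q_sym i j : q i j = q j i.
  by rewrite /q eq_sym (densityC R (@adj_sym _ G) (W i)).
have q_le4 i j : (q i j <= 4)%N by rewrite /q; case: ifP => // _; exact: level_le4.
have [||X X0 heavy] := min_degree_subset q_sym.
- by move=> i; rewrite /q eqxx.
- rewrite card_ord; apply: (dense_levels (g := g)); rewrite ?g0 ?g1 //.
    by move=> i j; exact: density_le1.
  have d0 : 8 / 13 + 2 * g <= density R (adj G) [set: 'I_n]%SET [set: 'I_n]%SET.
    rewrite /density cardT ler_pdivlMr ?mulr_gt0 //.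
    have := two_mul_edges G; rewrite -(ler_nat R) natrM => le.
    apply: le_trans le; rewrite -expr2.
    have : (4 / 13 + g) * n%:R ^+ 2 <= (4 / 13 + gamma) * n%:R ^+ 2.
      by rewrite ler_wpM2r ?exprn_ge0 // lerD2l.
    move: many; lra.
  move: dens; rewrite card_ord sum_offdiag; apply: le_trans.
  apply: ler_wpM2l => //; rewrite mulr_ge0 //.
  by rewrite subr_ge0 ler1n.
have [S S6 S12] := rich_sequence q_sym q_le4 X0 heavy.
have [|i A AW Alarge|||C [Cc Cs _]] := embed_clique (@adj_sym _ G) (@adj_irr _ G)
   mu01 eps0 eps_mu W0 q_le4 _ _ (S := S) (rho := 1) (U := W).
- move=> i j; rewrite /q; case: eqP => // /eqP ij /level_gt0 lv.
  by split; [move: lv; rewrite /mu; lra|exact: reg].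
- have nA : (0 < n <= M * #|A|)%N.
    rewrite n0; apply: large; apply: le_trans Alarge.
    by rewrite mulrAC [leRHS]mulrC; apply: ler_wpM2r => //; exact: ltW.
  apply: contrapT => none.
  have QM : (Q 4 n <= M * indep_num G)%N.
    apply: (Q_le_of_K_free nA) => C CA Cc; apply/eqP => C4.
    by apply: none; exists C.
  have := Q_gt0 4 n0; rewrite -(ltr0n R) => Q0.
  move: QM; rewrite -(ler_nat R) natrM leNgt => /negP; apply.
  apply: le_lt_trans (ler_wpM2l _ alpha) _ => //.
  rewrite mulrA gtr_pMl // ltr_pdivrMr ?mul1r ?ltr_nat //.
- rewrite mulr1; apply: le_trans (_ : (mu / 16) ^+ 6 <= _).
    have : (size S).+1%:R <= 7 :> R by rewrite ler_nat.
    rewrite /eps; nra.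
  by rewrite ler_wiXn2l // ltW.
- by move=> i _; rewrite mul1r; split.
move/negP: free; apply; apply: contains_K Cc _.
by rewrite Cs.
Qed.

(** * Passing to upper densities *)

Lemma le_RT (R : realType) (W : finType) (H : sgraph W) n (a b : R) :
  a <= b -> (RT H n a <= RT H n b)%N.
Proof.
move=> ab; apply/bigmax_leqP => G /andP[free Ga].
apply: (@leq_bigmax_cond _ _ (fun G : sgraph 'I_n => #|edges G|)).
by rewrite free (le_trans Ga).
Qed.

Lemma limn_esup_le (R : realType) (u v : nat -> \bar R) (N : nat) :
  (forall n, (N <= n)%N -> (u n <= v n)%E) -> (limn_esup u <= limn_esup v)%E.
Proof.
move=> uv; rewrite !limn_esup_lim; apply: lee_lim; try exact: is_cvg_esups.
exists N => // n /= Nn; apply: ge_ereal_sup => _ [m /= nm <-].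
apply: le_trans (uv m (leq_trans Nn nm)) _.
by apply: ereal_sup_ubound; exists m.
Qed.

Theorem theorem1p5 (R : realType) :
  rhotau_o_le (K 12) (fun n : nat => (Q 4 n)%:R : R) (4 / 13) /\
  (forall gamma : R, 0 < gamma ->
    exists delta : R, 0 < delta /\
    exists N : nat, forall n : nat, (N <= n)%N ->
    forall G : sgraph 'I_n,
      graph_free (K 12) G ->
      (indep_num G)%:R <= delta * (Q 4 n)%:R ->
      (#|edges G|)%:R <= (4 / 13 + gamma) * n%:R ^+ 2).
Proof.
split; last exact: edge_bound.
rewrite /rhotau_o_le; set F := fun delta : R => _.
(* Monotonicity in [delta] makes the limit from the right exist and equal the infimum of [F] over
   positive [delta]. *)
have Fmono : {in Interval (BRight (0 : R)) +oo%O &, {homo F : x y / x <= y >-> (x <= y)%E}}.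
  move=> x y _ _ xy; apply: (@limn_esup_le _ _ _ 0) => n _.
  rewrite lee_fin ler_wpM2r ?invr_ge0 ?exprn_ge0 // ler_nat.
  by apply: le_RT; apply: ler_wpM2r.
have lim := nondecreasing_at_right_cvge +oo%O isT Fmono.
split; first by apply/cvg_ex; eexists; exact: lim.
rewrite (cvg_lim _ lim) //; apply/lee_addgt0Pr => gamma gamma0.
have [delta [delta0 [N bound]]] := edge_bound gamma0.
apply: (@le_trans _ _ (F delta)).
  by apply: ereal_inf_lbound; exists delta => //=; rewrite in_itv /= delta0.
have lim_cst_esup : limn_esup (fun _ : nat => (4 / 13 + gamma)%:E) = (4 / 13 + gamma)%:E.
  rewrite is_cvg_limn_esupE; last exact: is_cvg_cst.
  exact: lim_cst.
(* Starting from [maxn N 1] ensures [0 < n], so the division by n^2 can be cleared. *)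
rewrite -EFinD -lim_cst_esup; apply: (@limn_esup_le _ _ _ (maxn N 1)) => n.
rewrite geq_max => /andP[Nn n0]; rewrite lee_fin ler_pdivrMr ?exprn_gt0 ?ltr0n //.
rewrite /RT; elim/big_ind: _ => [|a b ha hb|G /andP[free alpha]].
- by rewrite mulr_ge0 ?exprn_ge0 // addr_ge0 // ltW.
- by rewrite /maxn; case: ifP.
- exact: bound.
Qed.
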